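(* Let $m\in\mathcal{A}^c$ (not necessarily generic, i.e. $\mathrm{Disc}(Q_m)$ is allowed to vanish). Then the polynomial invariants $\tilde p_3(m)$, $\tilde p_2(m)$, $\mathrm{Disc}(Q_m)$ and $\mathrm{Inv}_m$ satisfy the following identity in $L^6$: $$27\,\mathrm{Disc}(Q_m)\,\tilde p_3(m)^2+4\,\tilde p_2(m)^3=-2^4\cdot 3^6\,\mathrm{Inv}_m^2 .$$
   Context: $\mathbb{F}$ is a field of characteristic different from $2$ and $3$, and $V$ is a two-dimensional $\mathbb{F}$-vector space. $L=\Lambda^2(V^* )$ is the one-dimensional space of antisymmetric bilinear forms on $V$, $L^{-1}$ its dual (identified with $\Lambda^2 V$), and $L^r$ denotes the $r$-th tensor power, with $L^r\otimes L^s$ identified with $L^{r+s}$. $\mathcal{A}^c$ is the set of symmetric bilinear maps $m:V\times V\to V$ (commutative algebra structures on $V$). Let $(e_1,e_2)$ be a basis of $V$ with dual basis $(\epsilon_1,\epsilon_2)$, put $\omega=\epsilon_1\wedge\epsilon_2\in L$, and write $m(e_1,e_1)=ae_1+be_2$, $m(e_2,e_2)=ce_1+de_2$, $m(e_1,e_2)=ee_1+fe_2$ with $a,b,c,d,e,f\in\mathbb{F}$. The fundamental binary cubic of $m$ is $Q_m(v)=m(v,v)\wedge v\in L^{-1}$; thus $Q_m(xe_1+ye_2)=q(x,y)\,e_1\wedge e_2$ with $q(x,y)=-bx^3+(a-2f)x^2y+(2e-d)xy^2+cy^3$. Writing $q=Ax^3+Bx^2y+Cxy^2+Dy^3$, $$\mathrm{Disc}(Q_m)=(18ABCD+B^2C^2-4AC^3-4B^3D-27A^2D^2)\,\omega^2\in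 L^2 .$$ Put $\mu(x,y)=q_{xx}q_{yy}-q_{xy}^2$ (Hessian of $q$), $G(x,y)=q_x\mu_y-q_y\mu_x$, and $\tau=(d+e,\,-(a+f))\in\mathbb{F}^2$. Define $$\tilde p_3(m)=-8\,q(\tau)\,\omega^2\in L^2,\qquad \tilde p_2(m)=\mu(\tau)\,\omega^2\in L^2,\qquad \mathrm{Inv}_m=\tfrac1{54}\,G(\tau)\,\omega^3\in L^3 .$$ (The vector $(d+e)e_1-(a+f)e_2$ is the vector $v$ with $\omega(v,\cdot)=T_m$, where $T_m(v)=\mathrm{Tr}(w\mapsto m(v,w))$.) These elements do not depend on the choice of basis. *)

(* Defs.v *)
From HB Require Import structures.
From mathcomp Require Import all_boot all_order all_algebra.
From mathcomp Require Import mpoly ring.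
Set Implicit Arguments.
Unset Strict Implicit.
Unset Printing Implicit Defensive.
Import GRing.Theory.
Local Open Scope ring_scope.

Section TwistedForms.
Variables (F : fieldType) (V : vectType F).

Definition bilin_form : vectType F := 'Hom(V, 'Hom(V, F^o)).

Section MkForm.
Variable f : V -> V -> F.
Hypothesis fl : forall v, scalar (f^~ v).
Hypothesis fr : forall u, scalar (f u).

Definition form_of : bilin_form :=
  linfun (fun u => linfun (f u : V -> F^o) : 'Hom(V, F^o)).

Lemma form_ofE u v : form_of u v = f u v.
Proof.
have rlin w : linear (f w : V -> F^o) by move=> a x y; exact: fr.
have inE w x : (linfun (f w : V -> F^o)) x = f w x.
  pose g := HB.pack_for {linear V -> F^o} (f w : V -> F^o)
    (GRing.isLinear.Build F V F^o _ _ (rlin w)).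
  exact: (lfunE g x).
have llin : linear (fun u => linfun (f u : V -> F^o) : 'Hom(V, F^o)).
  move=> a x y; apply/lfunP => z.
  by rewrite add_lfunE scale_lfunE !inE fl.
pose g := HB.pack_for {linear V -> 'Hom(V, F^o)}
  (fun u => linfun (f u : V -> F^o) : 'Hom(V, F^o))
  (GRing.isLinear.Build F V 'Hom(V, F^o) _ _ llin).
by rewrite /form_of -[linfun _]/(linfun g) lfunE /= inE.
Qed.
End MkForm.

Definition form_sym (phi : bilin_form) : bilin_form :=
  form_of (fun u v => phi u v + phi v u).

Lemma form_symE phi u v : form_sym phi u v = phi u v + phi v u.
Proof.
rewrite form_ofE //.
- by move=> w a x y; rewrite !linearP add_lfunE scale_lfunE mulrDr addrACA.
- by move=> w a x y; rewrite !linearP add_lfunE scale_lfunE mulrDr addrACA.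
Qed.

Lemma form_sym_linear : linear form_sym.
Proof.
move=> a x y; apply/lfunP => u; apply/lfunP => v.
rewrite !(form_symE, add_lfunE, scale_lfunE) /= scalerDr.
by rewrite addrACA.
Qed.
HB.instance Definition _ :=
  GRing.isLinear.Build F bilin_form bilin_form _ form_sym form_sym_linear.

(* [Lambda^2 (V^* )]; see [mem_asym_forms]. *)
Definition asym_forms : {vspace bilin_form} := lker (linfun form_sym).

Lemma mem_asym_forms (phi : bilin_form) :
  reflect (forall u v, phi u v = - phi v u) (phi \in asym_forms).
Proof.
rewrite memv_ker lfunE /=; apply: (iffP eqP) => [h u v | h].
  by apply/eqP; rewrite -addr_eq0 -form_symE h !lfunE.
by apply/lfunP => u; apply/lfunP => v; rewrite form_symE h addNr !lfunE.
Qed.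

Definition L : vectType F := subvs_of asym_forms.
Definition Linv : vectType F := 'Hom(L, F^o).

Definition evalL (l : L) (u v : V) : F := (vsval l : bilin_form) u v.

(* [u ^ v] in [Lambda^2 V], seen as the evaluation functional on [L]. *)
Definition wedge (u v : V) : Linv := linfun (fun l : L => evalL l u v : F^o).

Lemma wedgeE u v l : wedge u v l = evalL l u v.
Proof.
have lin : linear (fun l : L => evalL l u v : F^o).
  by move=> a x y; rewrite /evalL linearP /= !(add_lfunE, scale_lfunE).
pose g := HB.pack_for {linear L -> F^o} (fun l : L => evalL l u v : F^o)
    (GRing.isLinear.Build F L F^o _ _ lin).
exact: (lfunE g l).
Qed.

(* [L^r] is the space of [r]-linear forms on [Linv], the dual of [L]. *)
Fixpoint Lpow (r : nat) : vectType F :=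
  if r is r'.+1 then 'Hom(Linv, Lpow r') else F^o.

Fixpoint Lexp (l : L) (r : nat) : Lpow r :=
  if r is r'.+1 then linfun (fun u : Linv => (u l : F) *: Lexp l r') else 1.

Lemma LexpS l r u : Lexp l r.+1 u = (u l : F) *: Lexp l r.
Proof.
have lin : linear (fun u : Linv => (u l : F) *: Lexp l r).
  by move=> a x y; rewrite add_lfunE scale_lfunE scalerDl scalerA.
pose g := HB.pack_for {linear Linv -> Lpow r}
    (fun u : Linv => (u l : F) *: Lexp l r)
    (GRing.isLinear.Build F Linv (Lpow r) _ _ lin).
exact: (lfunE g u).
Qed.

(* The product [L^r (x) L^s -> L^(r + s)]. *)
Fixpoint Lmul (r s : nat) : Lpow r -> Lpow s -> Lpow (r + s) :=
  if r is r'.+1 return Lpow r -> Lpow s -> Lpow (r + s)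
  then fun x y => linfun (fun u : Linv => Lmul ((x : 'Hom(Linv, Lpow r')) u) y)
  else fun x y => (x : F) *: y.

Fact LmulS_subproof r s (y : Lpow s) :
    linear (fun x : Lpow r => Lmul x y) ->
  forall (x : Lpow r.+1) (u : Linv),
    (Lmul x y : 'Hom(Linv, Lpow (r + s))) u
      = Lmul ((x : 'Hom(Linv, Lpow r)) u) y.
Proof.
move=> ylin x u.
have lin : linear (fun u => Lmul ((x : 'Hom(Linv, Lpow r)) u) y).
  by move=> b w w'; rewrite linearP ylin.
pose g := HB.pack_for {linear Linv -> Lpow (r + s)}
  (fun u => Lmul ((x : 'Hom(Linv, Lpow r)) u) y)
  (GRing.isLinear.Build F Linv (Lpow (r + s)) _ _ lin).
exact: (lfunE g u).
Qed.

Lemma Lmul_linearl r s (y : Lpow s) : linear (fun x : Lpow r => Lmul x y).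
Proof.
elim: r => [|r IH] a x x'; first by rewrite /= scalerDl scalerA.
apply/(@lfunP F Linv (Lpow (r + s))) => u.
rewrite add_lfunE scale_lfunE !(LmulS_subproof IH).
by rewrite add_lfunE scale_lfunE IH.
Qed.

Lemma LmulS r s (x : Lpow r.+1) (y : Lpow s) (u : Linv) :
  (Lmul x y : 'Hom(Linv, Lpow (r + s))) u
    = Lmul ((x : 'Hom(Linv, Lpow r)) u) y.
Proof. exact/LmulS_subproof/Lmul_linearl. Qed.

End TwistedForms.

Section Invariants.
Variables (F : fieldType) (V : vectType F).

Record comm_algebra := CommAlgebra {
  cmul :> {bilinear V -> V -> V};
  cmulC : forall u v, cmul u v = cmul v u }.

Definition fundamental_cubic (m : comm_algebra) (v : V) : Linv V := wedge (m v v) v.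

Section Coordinates.
Variable e : 2.-tuple V.

Definition e1 : V := tnth e 0.
Definition e2 : V := tnth e 1.
Definition eps1 (v : V) : F := coord e 0 v.
Definition eps2 (v : V) : F := coord e 1 v.

Definition omega_form : bilin_form V :=
  form_of (fun u v => eps1 u * eps2 v - eps1 v * eps2 u).

Lemma omega_formE u v :
  omega_form u v = eps1 u * eps2 v - eps1 v * eps2 u.
Proof.
by rewrite form_ofE // => w a x y; rewrite /eps1 /eps2 !linearP /=; ring.
Qed.

Lemma omega_form_asym : omega_form \in asym_forms V.
Proof.
by apply/mem_asym_forms => u v; rewrite !omega_formE opprB.
Qed.

Definition omega : L V := Subvs omega_form_asym.

Variable m : comm_algebra.

Let a := eps1 (m e1 e1).
Let b := eps2 (m e1 e1).
Let c := eps1 (m e2 e2).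
Let d := eps2 (m e2 e2).
(* [e] is already the basis, so the scalar the mathematics calls [e] is [e']. *)
Let e' := eps1 (m e1 e2).
Let f := eps2 (m e1 e2).

Let x : {mpoly F[2]} := 'X_0.
Let y : {mpoly F[2]} := 'X_1.

Definition cubic_poly : {mpoly F[2]} :=
  (- b) *: x ^+ 3 + (a - 2%:R * f) *: (x ^+ 2 * y)
  + (2%:R * e' - d) *: (x * y ^+ 2) + c *: y ^+ 3.

Definition pair_val (s t : F) (i : 'I_2) : F := if i == 0 then s else t.

(* The coordinates of the vector [v] such that [omega v -] is the linear form *)
(* [u |-> Tr (m u -)]. *)
Definition tau : 'I_2 -> F := pair_val (d + e') (- (a + f)).
End Coordinates.

Definition cubic_disc (q : {mpoly F[2]}) : F :=
  let A := q@_(U_(0) *+ 3) in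
  let B := q@_(U_(0) *+ 2 + U_(1)) in
  let C := q@_(U_(0) + U_(1) *+ 2) in
  let D := q@_(U_(1) *+ 3) in
  18%:R * A * B * C * D + B ^+ 2 * C ^+ 2 - 4%:R * A * C ^+ 3
    - 4%:R * B ^+ 3 * D - 27%:R * A ^+ 2 * D ^+ 2.

Definition hessian (q : {mpoly F[2]}) : {mpoly F[2]} :=
  q^`M(0)^`M(0) * q^`M(1)^`M(1) - q^`M(0)^`M(1) ^+ 2.

Definition jacobian (p q : {mpoly F[2]}) : {mpoly F[2]} :=
  p^`M(0) * q^`M(1) - p^`M(1) * q^`M(0).

Definition DiscQ (e : 2.-tuple V) (m : comm_algebra) : Lpow V 2 :=
  cubic_disc (cubic_poly e m) *: Lexp (omega e) 2.

Definition p3 (e : 2.-tuple V) (m : comm_algebra) : Lpow V 2 :=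
  (- 8%:R * (cubic_poly e m).@[tau e m]) *: Lexp (omega e) 2.

Definition p2 (e : 2.-tuple V) (m : comm_algebra) : Lpow V 2 :=
  (hessian (cubic_poly e m)).@[tau e m] *: Lexp (omega e) 2.

Definition Inv (e : 2.-tuple V) (m : comm_algebra) : Lpow V 3 :=
  let q := cubic_poly e m in
  (54%:R^-1 * (jacobian q (hessian q)).@[tau e m]) *: Lexp (omega e) 3.

Lemma cubic_polyE (e : 2.-tuple V) (m : comm_algebra) (s t : F) :
  (cubic_poly e m).@[pair_val s t] =
    - eps2 e (m (e1 e) (e1 e)) * s ^+ 3
    + (eps1 e (m (e1 e) (e1 e)) - 2%:R * eps2 e (m (e1 e) (e2 e))) * (s ^+ 2 * t)
    + (2%:R * eps1 e (m (e1 e) (e2 e)) - eps2 e (m (e2 e) (e2 e))) * (s * t ^+ 2)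
    + eps1 e (m (e2 e) (e2 e)) * t ^+ 3.
Proof.
by rewrite /cubic_poly !(mevalD, mevalZ, mevalM, rmorphXn, mevalXU) /=.
Qed.

(* [cubic_poly] is the coordinate expression of the fundamental cubic. *)
Lemma fundamental_cubicE (e : 2.-tuple V) (m : comm_algebra) (s t : F) :
  2%N \notin [pchar F] -> basis_of fullv e ->
  fundamental_cubic m (s *: e1 e + t *: e2 e) =
    (cubic_poly e m).@[pair_val s t] *: wedge (e1 e) (e2 e).
Proof.
move=> F2 eB.
have eE v : v = eps1 e v *: e1 e + eps2 e v *: e2 e.
  have := coord_basis eB (memvf v).
  rewrite big_ord_recl big_ord1 /eps1 /eps2 /e1 /e2 !(tnth_nth 0).
  by rewrite (_ : lift ord0 ord0 = 1) //; apply: val_inj.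
apply/(@lfunP F (L V) F^o) => l; rewrite scale_lfunE !wedgeE /evalL.
have /mem_asym_forms := subvsP l.
move: (vsval l) => phi phiN.
have phi0 u : phi u u = 0.
  have /eqP := phiN u u; rewrite -addr_eq0 -mulr2n -mulr_natl mulf_eq0.
  case/orP=> [h|/eqP//]; case/negP: F2; rewrite inE /=; exact: h.
have phiE p q : phi (p *: e1 e + q *: e2 e) (s *: e1 e + t *: e2 e)
    = (p * t - q * s) * phi (e1 e) (e2 e).
  rewrite (linearD phi) !(linearZZ phi) add_lfunE !scale_lfunE.
  rewrite !(linearD (phi _)) !(linearZZ (phi _)) /= !phi0.
  rewrite (phiN (e2 e)) /GRing.scale /=; ring.
have mD : m (s *: e1 e + t *: e2 e) (s *: e1 e + t *: e2 e) =
    (s ^+ 2) *: m (e1 e) (e1 e) + (s * t *+ 2) *: m (e1 e) (e2 e)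
    + (t ^+ 2) *: m (e2 e) (e2 e).
  rewrite linearDl !linearDr !linearZl_LR !linearZr_LR /= (cmulC m (e2 e)).
  by rewrite !scalerA mulr2n scalerDl !addrA (mulrC t s) -!expr2.
have h11 := eE (m (e1 e) (e1 e)).
have h12 := eE (m (e1 e) (e2 e)).
have h22 := eE (m (e2 e) (e2 e)).
rewrite mD cubic_polyE {1}h11 {1}h12 {1}h22 !scalerDr !scalerA.
rewrite (addrACA (_ *: e1 e)) -!scalerDl (addrACA (_ *: e1 e)) -!scalerDl.
by rewrite phiE [in RHS]/GRing.scale /=; ring.
Qed.

End Invariants.

(* Main.v *)
Require Import Defs.
From HB Require Import structures.
From mathcomp Require Import all_boot all_order all_algebra.
From mathcomp Require Import mpoly.
From mathcomp Require Import ring.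
Set Implicit Arguments.
Unset Strict Implicit.
Unset Printing Implicit Defensive.
Import GRing.Theory.
Local Open Scope ring_scope.

(** Every term of the identity is a scalar times [omega ^ 6], because the
    product of [c omega ^ r] and [d omega ^ s] is [c d omega ^ (r + s)]
    ([Lmul_scale_Lexp]).  What remains is an identity between scalars: Cayley's
    syzygy between a binary cubic [q], its Hessian [H], the Jacobian [G] of [q]
    and [H], and the discriminant,
      [432 Disc(q) q ^ 2 + H ^ 3 = - G ^ 2],
    evaluated at the vector [tau] ([cubic_syzygy]).  The syzygy is formal: it
    holds at every vector and for every cubic, degenerate or not.

    Conceptually, [q], [H], [G] are covariants, both sides transform in the same
    way under linear substitutions, and a generic cubic is, over an algebraically
    closed field of characteristic different from 2 and 3, equivalent to
    [x ^ 3 + y ^ 3].  There [H = 36 x y], [G = 108 (x ^ 3 - y ^ 3)],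
    [Disc = - 27], and the syzygy becomes
      [(x ^ 3 + y ^ 3) ^ 2 - 4 x ^ 3 y ^ 3 = (x ^ 3 - y ^ 3) ^ 2].
    Both sides have integer coefficients in the coefficients of [q] and the
    variables, so this gives the formal identity.  The proof here instead expands
    it, with the derivatives and the Hessian of a general cubic in explicit
    form, which is uniform in the field. *)

Lemma Lmul_scaler (F : fieldType) (V : vectType F) (r s : nat) (c : F)
    (x : Lpow V r) (y : Lpow V s) :
  Lmul x (c *: y) = c *: Lmul x y.
Proof.
elim: r => [|r IHr] in x *; first by rewrite /= !scalerA mulrC.
apply/(@lfunP F (Linv V) (Lpow V (r + s))) => u.
by rewrite scale_lfunE !LmulS IHr.
Qed.

Lemma Lmul_scalel (F : fieldType) (V : vectType F) (r s : nat) (c : F)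
    (x : Lpow V r) (y : Lpow V s) :
  Lmul (c *: x) y = c *: Lmul x y.
Proof.
elim: r => [|r IHr] in x *; first by rewrite /= scalerA.
apply/(@lfunP F (Linv V) (Lpow V (r + s))) => u.
by rewrite scale_lfunE !LmulS scale_lfunE IHr.
Qed.

Lemma Lmul_Lexp (F : fieldType) (V : vectType F) (l : L V) (r s : nat) :
  Lmul (Lexp l r) (Lexp l s) = Lexp l (r + s).
Proof.
elim: r => [|r IHr]; first by rewrite /= scale1r.
apply/(@lfunP F (Linv V) (Lpow V (r + s))) => u.
by rewrite LmulS !LexpS Lmul_scalel IHr.
Qed.

(** Reduces an identity between products of multiples of powers of one element
    of [L] to an identity between scalars. *)
Lemma Lmul_scale_Lexp (F : fieldType) (V : vectType F) (l : L V) (r s : nat)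
    (c d : F) :
  Lmul (c *: Lexp l r) (d *: Lexp l s) = (c * d) *: Lexp l (r + s).
Proof. by rewrite Lmul_scalel Lmul_scaler Lmul_Lexp scalerA. Qed.

Definition binary_quadratic (F : fieldType) (P Q R : F) : {mpoly F[2]} :=
  P *: 'X_0 ^+ 2 + Q *: ('X_0 * 'X_1) + R *: 'X_1 ^+ 2.

Definition binary_cubic (F : fieldType) (A B C D : F) : {mpoly F[2]} :=
  A *: 'X_0 ^+ 3 + B *: ('X_0 ^+ 2 * 'X_1)
  + C *: ('X_0 * 'X_1 ^+ 2) + D *: 'X_1 ^+ 3.

Section BinaryForms.
Variable F : fieldType.
Implicit Types A B C D P Q R : F.

Local Notation x := ('X_0 : {mpoly F[2]}).
Local Notation y := ('X_1 : {mpoly F[2]}).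

Lemma mderiv_vars :
  (x^`M(0) = 1) * (x^`M(1) = 0) * (y^`M(0) = 0) * (y^`M(1) = 1).
Proof.
by do ![split]; rewrite mderivX mnm1E ?scale0r // scale1r
  -{1}[U_(_)%MM]add0m addmK mpolyX0.
Qed.

Let mderivE := (mderivD, mderivZ, mderivM, mderiv_vars).

Lemma mderiv_binary_quadratic P Q R :
  ((binary_quadratic P Q R)^`M(0) = (2%:R * P) *: x + Q *: y) *
  ((binary_quadratic P Q R)^`M(1) = Q *: x + (2%:R * R) *: y).
Proof.
by split; rewrite /binary_quadratic !expr2 !mderivE -!mul_mpolyC !rmorphM
  rmorph_nat /=; ring.
Qed.

Lemma mderiv_binary_cubic A B C D :
  ((binary_cubic A B C D)^`M(0)
     = binary_quadratic (3%:R * A) (2%:R * B) C) *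
  ((binary_cubic A B C D)^`M(1)
     = binary_quadratic B (2%:R * C) (3%:R * D)).
Proof.
by split; rewrite /binary_cubic /binary_quadratic !exprS !expr0 !mulr1 !mderivE
  -!mul_mpolyC !rmorphM !rmorph_nat /=; ring.
Qed.

(** Having the Hessian as an explicit quadratic form keeps the expansion in
    [cubic_syzygy] small: only first derivatives of a quadratic form remain to
    be taken there. *)
Lemma hessian_binary_cubic A B C D :
  hessian (binary_cubic A B C D) =
    binary_quadratic (12%:R * A * C - 4%:R * B ^+ 2)
      (36%:R * A * D - 4%:R * B * C) (12%:R * B * D - 4%:R * C ^+ 2).
Proof.
rewrite /hessian !mderiv_binary_cubic !mderiv_binary_quadratic /binary_quadratic.
rewrite -!mul_mpolyC.
rewrite !(rmorphB, rmorphM, rmorphXn, rmorph_nat) /=; ring.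
Qed.

(** Reduces the comparison of two monomials to that of their exponents, so that
    the coefficients of an explicit polynomial can be computed. *)
Lemma eq_mnm2 (m1 m2 : 'X_{1..2}) :
  (m1 == m2) = (m1 0 == m2 0) && (m1 1 == m2 1).
Proof.
apply/eqP/andP => [-> // | [/eqP h0 /eqP h1]].
by apply/mnmP; case=> [[|[|//]] lti]; [move: h0 | move: h1];
  congr (m1 _ = m2 _); apply: val_inj.
Qed.

Lemma cubic_disc_binary_cubic A B C D :
  cubic_disc (binary_cubic A B C D) =
    18%:R * A * B * C * D + B ^+ 2 * C ^+ 2 - 4%:R * A * C ^+ 3
    - 4%:R * B ^+ 3 * D - 27%:R * A ^+ 2 * D ^+ 2.
Proof.
rewrite /cubic_disc /binary_cubic !mpolyXn -!mpolyXD.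
rewrite !(mcoeffD, mcoeffZ, mcoeffX) !eq_mnm2 !(mnmDE, mulmnE, mnm1E) /=.
by rewrite !(mulr0, mulr1, addr0, add0r).
Qed.

(** Cayley's syzygy, the single relation between the covariants of a binary
    cubic.  The factor 432 comes from the normalizations of the Hessian and the
    Jacobian; on [x ^ 3 + y ^ 3] it is [108 ^ 2 / 27]. *)
Lemma cubic_syzygy A B C D (v : 'I_2 -> F) (q := binary_cubic A B C D) :
  432%:R * cubic_disc q * q.@[v] ^+ 2 + (hessian q).@[v] ^+ 3
    = - (jacobian q (hessian q)).@[v] ^+ 2.
Proof.
rewrite /q cubic_disc_binary_cubic /jacobian hessian_binary_cubic.
rewrite !mderiv_binary_cubic !mderiv_binary_quadratic.
rewrite /binary_cubic /binary_quadratic.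
rewrite !(mevalB, mevalD, mevalZ, mevalM, rmorphXn, mevalXU) /=.
ring.
Qed.
End BinaryForms.

(** The syzygy in the normalization of the invariants: it is multiplied by 4,
    since [27 * 8 ^ 2 = 4 * 432] on the left and
    [2 ^ 4 * 3 ^ 6 = 4 * 54 ^ 2] on the right. *)
Lemma rescale_syzygy (F : fieldType) (disc q h g : F) :
  54%:R != 0 :> F ->
  432%:R * disc * q ^+ 2 + h ^+ 3 = - g ^+ 2 ->
  27%:R * (disc * ((- 8%:R * q) * (- 8%:R * q))) + 4%:R * (h * (h * h))
    = - (2%:R ^+ 4 * 3%:R ^+ 6) * ((54%:R^-1 * g) * (54%:R^-1 * g)).
Proof.
move=> n54_neq0 syz.
transitivity (- 4%:R * g ^+ 2); last by field.
have -> : - 4%:R * g ^+ 2 = 4%:R * (- g ^+ 2) by ring.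
by rewrite -syz; ring.
Qed.

Theorem theorem1p1 (F : fieldType) (V : vectType F)
    (charF2 : 2%N \notin [pchar F]) (charF3 : 3%N \notin [pchar F])
    (dimV : \dim {:V} = 2%N)
    (m : comm_algebra V) (e : 2.-tuple V) (eB : basis_of {:V} e) :
  27%:R *: Lmul (DiscQ e m) (Lmul (p3 e m) (p3 e m))
    + 4%:R *: Lmul (p2 e m) (Lmul (p2 e m) (p2 e m))
  = - (2%:R ^+ 4 * 3%:R ^+ 6) *: Lmul (Inv e m) (Inv e m) :> Lpow V 6.
Proof.
have n54_neq0 : 54%:R != 0 :> F.
  have -> : 54%:R = 2%:R * 3%:R ^+ 3 :> F by ring.
  by rewrite mulf_neq0 ?expf_neq0.
rewrite /DiscQ /p3 /p2 /Inv !Lmul_scale_Lexp !scalerA -scalerDl.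
(* Naming the scalars lets them be replaced without comparing the types        *)
(* [Lpow V (2 + (2 + 2))] and [Lpow V (3 + 3)] by unfolding.                   *)
set lhs := (X in X *: _ = _); set rhs := (X in _ = X *: _).
suff -> : lhs = rhs by [].
rewrite {}/lhs {}/rhs; set q := cubic_poly e m.
have : 432%:R * cubic_disc q * q.@[tau e m] ^+ 2 + (hessian q).@[tau e m] ^+ 3
    = - (jacobian q (hessian q)).@[tau e m] ^+ 2 by exact: cubic_syzygy.
exact: rescale_syzygy n54_neq0.
Qed.
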